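(* There is a universal constant $K>0$ such that for every finite metric space $(X,d_X)$ with $|X|=n\ge 2$, $\mathsf{La}(X)$ bi-Lipschitzly embeds into $L_1$ with distortion at most $K\log n$. In particular (since $\log n=O(\log\log|\mathsf{La}(X)|)$) the distortion is $O(\log n)=O(\log\log|\mathsf{La}(X)|)$, with universal implied constants.
   Context: For a finite metric space $(X,d_X)$, points $x,y\in X$ and $C\subset X$, $\mathrm{tsp}_X(x,C,y)$ is the minimum of $\sum_{i=1}^n d_X(x_{i-1},x_i)$ over all finite sequences $x_0,\dots,x_n$ ($n\ge0$) in $X$ with $x_0=x$, $x_n=y$, $C\subset\{x_0,\dots,x_n\}$. The lamplighter metric space $\mathsf{La}(X)$ is the set of pairs $(A,x)$, with $A$ a finite subset of $X$ and $x\in X$, with the metric $d_{\mathsf{La}(X)}((A,x),(B,y))=\mathrm{tsp}_X(x,A\triangle B,y)+|A\triangle B|$. A metric space $(M,d_M)$ bi-Lipschitzly embeds into $L_1$ with distortion at most $D$ if there are $s>0$ and $f\colon M\to L_1$ with $s\,d_M(x,y)\le\|f(x)-f(y)\|_1\le D s\,d_M(x,y)$ for all $x,y\in M$. Logarithms are base 2. *)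

(* Defs.v *)
From HB Require Import structures.
From mathcomp Require Import all_boot all_order all_algebra.
From mathcomp Require Import all_classical all_reals all_analysis.

Set Implicit Arguments.
Unset Strict Implicit.
Unset Printing Implicit Defensive.

Import Order.TTheory GRing.Theory Num.Theory.

Local Open Scope classical_set_scope.
Local Open Scope ring_scope.

#[short(type="finMetricType")]
HB.structure Definition FinMetric (R : numDomainType) :=
  {T of Finite T & Metric R T}.

Definition log2 {R : realType} (x : R) : R := ln x / ln 2.

Section TSP.
Variables (R : realType) (X : finMetricType R).
Implicit Types (x y z : X) (s t : seq X) (C : {set X}).

(* The sequence x_0, ..., x_n is encoded as x :: s, so that n = size s. *)
Definition walk_length x s : R := \sum_(d <- pairmap mdist x s) d.

Definition tsp_walk x C y s : Prop :=
  last x s = y /\ {subset C <= x :: s}.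

(* The infimum is attained, see tsp_attained below. *)
Definition tsp x C y : R := inf [set walk_length x s | s in tsp_walk x C y].

Lemma walk_length_nil x : walk_length x [::] = 0.
Proof. by rewrite /walk_length big_nil. Qed.

Lemma walk_length_cons x y s :
  walk_length x (y :: s) = mdist x y + walk_length y s.
Proof. by rewrite /walk_length /= big_cons. Qed.

Lemma walk_length_cat x s t :
  walk_length x (s ++ t) = walk_length x s + walk_length (last x s) t.
Proof. by rewrite /walk_length pairmap_cat big_cat. Qed.

Lemma walk_length_ge0 x s : 0 <= walk_length x s.
Proof.
elim: s x => [|y s IHs] x; first by rewrite walk_length_nil.
by rewrite walk_length_cons addr_ge0 ?mdist_ge0.
Qed.

Lemma mdist_le_walk_length x s : mdist x (last x s) <= walk_length x s.
Proof.
elim: s x => [|y s IHs] x /=; first by rewrite walk_length_nil mdistxx.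
rewrite walk_length_cons.
by apply: le_trans (metric_triangle _ y _) _; rewrite lerD2l.
Qed.

Lemma walk_length_rev x s :
  walk_length (last x s) (rev (belast x s)) = walk_length x s.
Proof.
elim: s x => [|y s IHs] x //=.
rewrite rev_cons -cats1 walk_length_cat IHs !walk_length_cons walk_length_nil.
rewrite addr0 [RHS]addrC metric_sym; congr (_ + mdist x _).
case: s {IHs} => [|z s] //=.
by rewrite rev_cons last_rcons.
Qed.

Lemma walk_length_subseq x y s t : subseq s t ->
  walk_length x (rcons s y) <= walk_length x (rcons t y).
Proof.
elim: t x s => [|b t IHt] x [|a s] //= sst.
- rewrite walk_length_cons walk_length_nil addr0.
  by have := mdist_le_walk_length x (rcons (b :: t) y); rewrite last_rcons.
- move: sst; case: eqVneq => [->|_] sst.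
    by rewrite !walk_length_cons lerD2l IHt.
  apply: le_trans (IHt x _ sst) _; rewrite walk_length_cons.
  case: t {IHt sst} => [|c t] /=; rewrite !walk_length_cons addrA lerD2r;
    exact: metric_triangle.
Qed.

Lemma tsp_attained x C y :
  exists2 s, tsp_walk x C y s & tsp x C y = walk_length x s.
Proof.
pose N := #|X|.+1.
pose P := [pred s : N.-bseq X |
  (last x s == y) && [forall z in C, z \in x :: (s : seq X)]].
have PP (s : N.-bseq X) : reflect (tsp_walk x C y s) (P s).
  apply: (iffP andP) => [[/eqP ? /forall_inP Cs]|[? Cs]]; first by split.
  by split; [exact/eqP | apply/forall_inP].
have short s : tsp_walk x C y s -> exists2 t : N.-bseq X,
    P t & walk_length x t <= walk_length x s.
  case/lastP: s => [|s z] [sy Cs].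
    by exists [bseq] => //; apply/PP.
  have sz : (size (rcons (undup s) z) <= N)%N.
    by rewrite size_rcons ltnS -(card_uniqP (undup_uniq s)) max_card.
  exists (Bseq sz); last by apply: walk_length_subseq; exact: undup_subseq.
  apply/PP; split => [|c /Cs] /=.
    by move: sy; rewrite !last_rcons.
  by rewrite !inE !mem_rcons !inE mem_undup.
have [t0 Pt0 _] : exists2 t : N.-bseq X,
    P t & walk_length x t <= walk_length x (rcons (enum C) y).
  apply: short; split; first by rewrite last_rcons.
  by move=> c cC; rewrite inE mem_rcons inE mem_enum cC !orbT.
case: (arg_minP (fun t : N.-bseq X => walk_length x t) Pt0) => t Pt tmin.
have lbt : lbound [set walk_length x s | s in tsp_walk x C y] (walk_length x t).
  by move=> _ [s /short[u Pu us] <-]; exact: le_trans (tmin _ Pu) us.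
exists t; first exact/PP.
apply/eqP; rewrite eq_le; apply/andP; split.
  by apply: ge_inf; [exists (walk_length x t) | exists t => //; exact/PP].
by apply: lb_le_inf => //; exists (walk_length x t), t => //; exact/PP.
Qed.

Lemma tsp_le x C y s : tsp_walk x C y s -> tsp x C y <= walk_length x s.
Proof.
move=> ws; apply: ge_inf; last by exists s.
by exists 0 => _ [t _ <-]; exact: walk_length_ge0.
Qed.

Lemma mdist_le_tsp x C y : mdist x y <= tsp x C y.
Proof.
by have [s [<- _] ->] := tsp_attained x C y; exact: mdist_le_walk_length.
Qed.

Lemma tsp0 x : tsp x finset.set0 x = 0.
Proof.
apply/eqP; rewrite eq_le (le_trans (mdist_ge0 x x) (mdist_le_tsp _ _ _)) andbT.
rewrite -(walk_length_nil x); apply: tsp_le; split=> // z; by rewrite inE.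
Qed.

Lemma tsp_sym_le x C y : tsp x C y <= tsp y C x.
Proof.
have [s [sx Cs] ->] := tsp_attained y C x.
rewrite -walk_length_rev sx; apply: tsp_le; split.
  rewrite -sx; case: s {sx Cs} => [|z s] //=.
  by rewrite rev_cons last_rcons.
by move=> c /Cs; rewrite lastI sx mem_rcons !inE mem_rev.
Qed.

Lemma tsp_sym x C y : tsp x C y = tsp y C x.
Proof. by apply/eqP; rewrite eq_le !tsp_sym_le. Qed.

Lemma tsp_triangle x y z C1 C2 C : C \subset C1 :|: C2 ->
  tsp x C z <= tsp x C1 y + tsp y C2 z.
Proof.
move=> /fintype.subsetP sC.
have [s [sy C1s] ->] := tsp_attained x C1 y.
have [t [tz C2t] ->] := tsp_attained y C2 z.
rewrite -{1}sy -walk_length_cat; apply: tsp_le; split.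
  by rewrite last_cat sy.
move=> c /sC; rewrite inE => /orP[/C1s|/C2t].
  by rewrite !inE mem_cat orbA => ->.
rewrite inE => /orP[/eqP->|ct]; last by rewrite inE mem_cat ct !orbT.
by rewrite -cat_cons mem_cat -sy mem_last.
Qed.

End TSP.

Definition symdiff (T : finType) (A B : {set T}) : {set T} :=
  (A :\: B) :|: (B :\: A).

(* Every subset of a finite space is finite, hence {set X}. *)
Definition La (R : realType) (X : finMetricType R) : Type := ({set X} * X)%type.

Section Lamplighter.
Variables (R : realType) (X : finMetricType R).

HB.instance Definition _ := Finite.copy (La X) ({set X} * X)%type.

Definition La_dist (p q : La X) : R :=
  tsp p.2 (symdiff p.1 q.1) q.2 + #|symdiff p.1 q.1|%:R.

Lemma symdiffxx (A : {set X}) : symdiff A A = finset.set0.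
Proof. by rewrite /symdiff finset.setDv finset.setU0. Qed.

Lemma symdiffC (A B : {set X}) : symdiff A B = symdiff B A.
Proof. exact: finset.setUC. Qed.

Lemma symdiff_eq0 (A B : {set X}) : symdiff A B = finset.set0 -> A = B.
Proof.
move/eqP; rewrite finset.setU_eq0 !finset.setD_eq0 => /andP[AB BA].
by apply/eqP; rewrite finset.eqEsubset AB.
Qed.

Lemma symdiff_triangle (A B C : {set X}) :
  symdiff A C \subset symdiff A B :|: symdiff B C.
Proof.
by apply/fintype.subsetP => z; rewrite !inE; case: (z \in A); case: (z \in B);
  case: (z \in C).
Qed.

Lemma La_distxx p : La_dist p p = 0.
Proof. by rewrite /La_dist symdiffxx tsp0 finset.cards0 addr0. Qed.

Lemma La_dist_positivity p q : La_dist p q = 0 -> p = q.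
Proof.
case: p q => [A x] [B y]; rewrite /La_dist /= => /eqP.
have d0 : 0 <= mdist x y := mdist_ge0 x y.
have dt := mdist_le_tsp x (symdiff A B) y.
rewrite paddr_eq0 ?ler0n// ?(le_trans d0 dt)// => /andP[/eqP t0].
rewrite pnatr_eq0 finset.cards_eq0 => /eqP/symdiff_eq0 ->; congr pair.
by apply: (@mdist_positivity R); apply/eqP; rewrite eq_le d0 andbT -t0.
Qed.

Lemma La_dist_sym p q : La_dist p q = La_dist q p.
Proof. by rewrite /La_dist symdiffC tsp_sym. Qed.

Lemma La_dist_triangle q p r : La_dist p r <= La_dist p q + La_dist q r.
Proof.
rewrite /La_dist addrACA lerD ?(tsp_triangle _ _ _ (symdiff_triangle _ _ _))//.
rewrite -natrD ler_nat.
apply: leq_trans (subset_leq_card (symdiff_triangle _ q.1 _)) _.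
exact: leq_card_setU.
Qed.

HB.instance Definition _ := isMetric.Build R (La X)
  La_distxx La_dist_positivity La_dist_sym La_dist_triangle.

End Lamplighter.

(* L_1 is L_1[0, 1]; f maps each point to a representative of its class, which
   the norm of differences does not depend on. *)
Definition L1_embeds (R : realType) (M : metricType R) (D : R) : Prop :=
  exists s : R, 0 < s /\ exists f : M -> R -> R,
    (forall x, lebesgue_measure.-integrable `[0, 1] (EFin \o f x)) /\
    forall x y,
      s * mdist x y <= \int[lebesgue_measure]_(t in `[0, 1]) `|f x t - f y t|
        <= D * s * mdist x y.

(* Main.v *)
Require Import Defs.
From mathcomp Require Import all_boot all_order all_fingroup all_algebra.
From mathcomp Require Import all_classical all_reals all_analysis.
From mathcomp Require Import lra.

(* A cut S of X induces a two-valued metric on La X: forget the lamps lying on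
   the same side of S as the lamplighter, and compare what is left.  It
   separates (A, x) and (B, y) exactly when S splits Y, the union of {x, y} and
   symdiff A B, and a walk realising the tsp crosses every cut that splits Y.
   So it suffices to find weighted cuts of X such that the weight of the cuts
   separating u and v is O(log n) d(u, v), whereas the weight of the cuts
   splitting Y dominates the tsp.

   The cuts are the clusters of the random partitions of Calinescu, Karloff and
   Rabani, as in the tree embedding of Fakcharoenphol, Rao and Talwar: for a
   uniform permutation pi and a radius r, u joins the pi-first point within
   distance r of it.  Integrating over r, a point w separates u and v on a set
   of radii of length at most d(u, v), and only if it is pi-first among the
   points at least as close to {u, v} as it is; this gives a harmonic sum.
   Clusters of radius r have diameter at most 2r, so a point of Y at distance
   delta from the others is alone in its cluster for r < delta / 2, and
   inserting the points of Y one by one into a tour costs at most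
   4 int (#clusters meeting Y - 1) dr.  No hierarchy between the scales is
   needed.  The integral over r is replaced by a sum over a grid whose step h
   is below the minimal distance. *)

Set Implicit Arguments.
Unset Strict Implicit.
Unset Printing Implicit Defensive.

Import Order.TTheory GRing.Theory Num.Theory.

Local Open Scope ring_scope.

(** * Finite sums *)

Section FiniteSums.
Variable R : realType.

(** Delete a maximiser of [m]: its own term is 1/|S|, and the deletion only shrinks the other
    counts, hence enlarges the other reciprocals. *)
Lemma sum_inv_card_le_harmonic (T : finType) (m : T -> R) (S : {set T}) :
  \sum_(w in S) (#|[set v in S | m v <= m w]|%:R : R)^-1 <=
  \sum_(i < #|S|) (i.+1%:R : R)^-1.
Proof.
have [n] := ubnP #|S|; elim: n S => // n IHn S; rewrite ltnS => leSn.
have [->|[w0 w0S]] := set_0Vmem S.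
  by rewrite big_set0 sumr_ge0.
case: (@arg_maxP _ _ _ w0 (fun w => w \in S) m w0S) => w wS wmax.
have cardS : #|S| = #|S :\ w|.+1 by rewrite (cardsD1 w) wS.
rewrite (big_setD1 w wS)/= cardS big_ord_recr/= addrC lerD//.
  rewrite (le_trans _ (IHn _ _)) -?cardS//.
  apply: ler_sum => v; rewrite !inE => /andP[vw vS].
  rewrite lef_pV2 ?posrE ?ltr0n ?ler_nat.
  - by apply/subset_leq_card/fintype.subsetP => z;
      rewrite !inE -andbA => /and3P[_ -> ->].
  - by apply/card_gt0P; exists v; rewrite inE vS/=.
  - by apply/card_gt0P; exists v; rewrite !inE vw vS/=.
rewrite lef_pV2 ?posrE ?ltr0n// -?cardS ?ler_nat.
  apply/subset_leq_card/fintype.subsetP => z zS; rewrite inE zS/=.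
  exact: wmax.
by apply/card_gt0P; exists w; rewrite inE wS/=.
Qed.

Lemma harmonic_le_ln (n : nat) :
  \sum_(i < n.+1) (i.+1%:R : R)^-1 <= 1 + ln n.+1%:R.
Proof.
elim: n => [|n IHn]; first by rewrite big_ord1 invr1 ln1 addr0.
rewrite big_ord_recr/= (le_trans (lerD IHn (lexx _)))// -addrA lerD2l.
rewrite -lerBrDl -lerN2 opprB -ln_div ?posrE ?ltr0n//.
(* With x = -1/(n+2), the claim becomes ln(1 + x) <= x. *)
have -> : n.+1%:R / n.+2%:R = 1 + - (n.+2%:R)^-1 :> R.
  apply: (@mulIf _ n.+2%:R); first by rewrite pnatr_eq0.
  rewrite divfK ?pnatr_eq0// mulrDl mul1r mulNr mulVf ?pnatr_eq0//.
  by rewrite -[n.+2%:R]natr1 addrK.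
apply: le_ln1Dx; rewrite ltrN2 invf_lt1 ?ltr0n// ltr1n//.
Qed.

Lemma sum_grid_interval_le (h a b : R) (N : nat) : 0 <= h -> a <= b ->
  \sum_(k < N) h * ((a <= k%:R * h) && (k%:R * h < b))%:R <= b - a + h.
Proof.
(* Each grid point in [a, b[ advances the truncation of t to [a, b + h] by h. *)
move=> h0 ab; pose g t := Num.min (Num.max t a) (b + h).
have step k : h * ((a <= k%:R * h) && (k%:R * h < b))%:R <=
    g (k.+1%:R * h) - g (k%:R * h).
  rewrite /g -natr1 mulrDl mul1r; set t := k%:R * h.
  case: (leP a t) => at_; case: (ltP t b) => tb /=; rewrite ?mulr1 ?mulr0;
    rewrite /Num.min /Num.max; repeat case: ltP => ?; lra.
apply: (@le_trans _ _ (\sum_(k < N) (g (k.+1%:R * h) - g (k%:R * h)))).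
  by apply: ler_sum => k _; exact: step.
rewrite -(big_mkord xpredT (fun k => g (k.+1%:R * h) - g (k%:R * h))).
rewrite telescope_sumr// /g addrAC lerB//.
  by rewrite ge_min lexx orbT.
by rewrite le_min le_max lexx orbT/= (le_trans ab)// lerDl.
Qed.

(** The truncation min(s, t) rises by at most h per grid step, and only from grid points below t;
    its total rise is t - min(0, t) >= t. *)
Lemma sum_grid_below_ge (h t : R) (N : nat) : 0 <= h -> t <= N%:R * h ->
  t <= \sum_(k < N) h * (k%:R * h < t)%R%:R.
Proof.
move=> h0 tN; pose g s := Num.min s t.
have step k : g (k.+1%:R * h) - g (k%:R * h) <= h * (k%:R * h < t)%R%:R.
  rewrite /g -natr1 mulrDl mul1r; set s := k%:R * h.
  case: (ltP s t) => st /=; rewrite ?mulr1 ?mulr0;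
    rewrite /Num.min; repeat case: ltP => ?; lra.
apply: (@le_trans _ _ (\sum_(k < N) (g (k.+1%:R * h) - g (k%:R * h))));
  last first.
  by apply: ler_sum => k _; exact: step.
rewrite -(big_mkord xpredT (fun k => g (k.+1%:R * h) - g (k%:R * h))).
rewrite telescope_sumr// /g mul0r (min_idPr tN) lerBrDr gerDl.
by rewrite ge_min lexx.
Qed.

End FiniteSums.

(** * Step functions and finite l1 *)

Section FiniteL1.
Local Open Scope classical_set_scope.
Variables (R : realType) (J : finType).

(** Half-open, so that cells of distinct indices are disjoint. *)
Definition grid_cell (j : J) : set R :=
  `[(enum_rank j)%:R / #|J|%:R, (enum_rank j).+1%:R / #|J|%:R[%classic.

Definition step_fun (c : J -> R) (t : R) : R :=
  \sum_j c j * \1_(grid_cell j) t.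

Lemma measurable_grid_cell j : measurable (grid_cell j).
Proof. exact: measurable_itv. Qed.

Lemma card_natr_gt0 (j : J) : 0 < #|J|%:R :> R.
Proof. by rewrite ltr0n; apply/card_gt0P; exists j. Qed.

Lemma grid_cell_inj i j t : grid_cell i t -> grid_cell j t -> i = j.
Proof.
have N0 := card_natr_gt0 i.
rewrite /grid_cell /= !in_itv/= !ler_pdivrMr// !ltr_pdivlMr//.
move=> /andP[i1 i2] /andP[j1 j2]; apply/enum_rank_inj/val_inj/eqP.
rewrite eqn_leq -ltnS -[X in _ && X]ltnS -!(ltr_nat R).
by rewrite (le_lt_trans i1 j2) (le_lt_trans j1 i2).
Qed.

(** At most one cell contains [t], so at most one summand is nonzero. *)
Lemma norm_step_fun c t : `|step_fun c t| = step_fun (fun j => `|c j|) t.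
Proof.
rewrite /step_fun; have [[j jt]|noj] := pselect (exists j, grid_cell j t).
  have z (d : J -> R) i : i != j -> d i * \1_(grid_cell i) t = 0.
    move=> ij; rewrite indicE memNset ?mulr0// => it.
    by rewrite (grid_cell_inj it jt) eqxx in ij.
  rewrite [X in `|X|](bigD1 j)//= [RHS](bigD1 j)//=.
  rewrite [X in `|_ + X|]big1 => [|i]; last exact: z.
  rewrite [X in _ = _ + X]big1 => [|i]; last exact: (z (fun i => `|c i|)).
  by rewrite !addr0 indicE mem_set// !mulr1.
have z (d : J -> R) i : d i * \1_(grid_cell i) t = 0.
  by rewrite indicE memNset ?mulr0// => it; apply: noj; exists i.
rewrite [X in `|X|]big1 => [|i _]; last exact: z.
by rewrite normr0 big1// => i _; exact: (z (fun i => `|c i|)).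
Qed.

Lemma lebesgue_measure_grid_cell j :
  lebesgue_measure (grid_cell j `&` `[0, 1]) = (#|J|%:R^-1)%:E.
Proof.
have N0 := card_natr_gt0 j.
rewrite setIidl; last first.
  move=> t; rewrite /grid_cell /= !in_itv/= => /andP[t1 t2].
  rewrite (le_trans _ t1) ?divr_ge0// (le_trans (ltW t2))//.
  by rewrite ler_pdivrMr// mul1r ler_nat ltn_ord.
rewrite lebesgue_measure_itv/= lte_fin ltr_pM2r ?invr_gt0// ltr_nat leqnn.
by rewrite -EFinB -mulrBl -natrB// subSnn mul1r.
Qed.

Lemma integrable_cell_term c j :
  lebesgue_measure.-integrable `[0, 1]
    (fun t => (c%:E * (\1_(grid_cell j) t)%:E)%E).
Proof.
apply: integrableZl => //.
apply: (integrableS measurableT) => //.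
exact: integrable_indic_itv.
Qed.

Lemma EFin_step_fun c t :
  (step_fun c t)%:E = (\sum_j (c j)%:E * (\1_(grid_cell j) t)%:E)%E.
Proof. by rewrite /step_fun -sumEFin. Qed.

Lemma integrable_step_fun c :
  lebesgue_measure.-integrable `[0, 1] (EFin \o step_fun c).
Proof.
rewrite (_ : EFin \o _ = fun t =>
    (\sum_j (c j)%:E * (\1_(grid_cell j) t)%:E)%E); last first.
  by apply/funext => t; exact: EFin_step_fun.
by apply: integrable_sum => // j _; exact: integrable_cell_term.
Qed.

Lemma Rintegral_step_fun c :
  \int[lebesgue_measure]_(t in `[0, 1]) step_fun c t =
  (\sum_j c j) / #|J|%:R.
Proof.
rewrite /Rintegral; under eq_integral do rewrite EFin_step_fun.
rewrite integral_sum//; last by move=> j; exact: integrable_cell_term.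
rewrite mulr_suml -[RHS]/(fine (\sum_j (c j / #|J|%:R))%:E) -sumEFin.
congr fine; apply: eq_bigr => j _.
rewrite integralZl//; last first.
  apply: (integrableS measurableT) => //.
  exact: integrable_indic_itv.
rewrite integral_indic//; last exact: measurable_grid_cell.
by rewrite [X in (_ * X)%E](lebesgue_measure_grid_cell j) EFinM.
Qed.

Lemma L1_embeds_of_l1 (M : metricType R) (v : M -> J -> R) (s D : R) :
  0 < s -> (0 < #|J|)%N ->
  (forall x y, s * mdist x y <= \sum_j `|v x j - v y j| <= D * s * mdist x y) ->
  L1_embeds M D.
Proof.
move=> s0 J0 vP; have N0 : 0 < #|J|%:R :> R by rewrite ltr0n.
(* Every cell has length 1/|J|, so integration divides the l1 norm by |J|. *)
exists (s / #|J|%:R); split; first exact: divr_gt0.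
exists (fun x => step_fun (v x)); split=> [x|x y].
  exact: integrable_step_fun.
under eq_Rintegral => t _.
  rewrite (_ : step_fun (v x) t - step_fun (v y) t =
      step_fun (fun j => v x j - v y j) t); last first.
    by rewrite /step_fun -sumrB; apply: eq_bigr => j _; rewrite mulrBl.
  rewrite norm_step_fun; over.
rewrite Rintegral_step_fun [D * _]mulrA -![_ / _ * mdist _ _]mulrAC.
by rewrite !ler_pM2r ?invr_gt0.
Qed.

End FiniteL1.

(** * Weighted sums of discrete metrics *)

Section DiscreteL1.
Variable R : realType.

Lemma sum_norm_diff_pred1 (T : finType) (x y : T) :
  \sum_z `|(x == z)%:R - (y == z)%:R| = 2 * (x != y)%:R :> R.
Proof.
have [<-|xy] := eqVneq x y.
  by rewrite big1 ?mulr0// => z _; rewrite subrr normr0.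
rewrite (bigD1 x)//= (bigD1 y)/=; last by rewrite eq_sym.
rewrite big1 => [|z /andP[zx zy]].
  rewrite !eqxx [y == x]eq_sym (negbTE xy)/= sub0r subr0 normrN normr1 addr0.
  by rewrite mulr1.
by rewrite [x == z]eq_sym (negbTE zx) [y == z]eq_sym (negbTE zy) subrr normr0.
Qed.

(** Each value in [T] becomes its indicator vector in l1(T); distinct values are then at distance 2,
    hence the scale [2 * s]. *)
Lemma L1_embeds_of_weighted_discrete (M : metricType R) (J T : finType)
    (w : J -> R) (g : M -> J -> T) (s D : R) :
  0 < s -> (0 < #|J|)%N -> (0 < #|T|)%N -> (forall j, 0 <= w j) ->
  (forall x y, s * mdist x y <= \sum_j w j * (g x j != g y j)%:R
     <= D * s * mdist x y) ->
  L1_embeds M D.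
Proof.
move=> s0 J0 T0 w0 gP.
apply: (@L1_embeds_of_l1 _ (J * T)%type M
  (fun x jt => w jt.1 * (g x jt.1 == jt.2)%:R) (2 * s)).
- by rewrite mulr_gt0.
- by rewrite card_prod muln_gt0 J0.
move=> x y.
rewrite -(pair_bigA _ (fun j t =>
  `|w j * (g x j == t)%:R - w j * (g y j == t)%:R|))/=.
rewrite (eq_bigr (fun j => 2 * (w j * (g x j != g y j)%:R))) => [|j _].
  by rewrite -mulr_sumr mulrCA -!mulrA !ler_pM2l// mulrA; exact: gP.
rewrite mulrCA -sum_norm_diff_pred1 mulr_sumr; apply: eq_bigr => t _.
by rewrite -mulrBr normrM ger0_norm.
Qed.

End DiscreteL1.

(** * Cuts of X and lamplighter cuts *)

Section Cuts.
Variables (R : realType) (X : finMetricType R).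
Implicit Types (S Y C : {set X}) (x y : X) (p q : La X).

Definition splits S Y : bool :=
  [exists a in Y, a \in S] && [exists b in Y, b \notin S].

Lemma splitsI S Y a b :
  a \in Y -> b \in Y -> a \in S -> b \notin S -> splits S Y.
Proof.
move=> aY bY aS bS.
by apply/andP; split; apply/exists_inP; [exists a | exists b].
Qed.

Definition lamp_cut S p : bool * {set X} :=
  (p.2 \in S, if p.2 \in S then p.1 :\: S else p.1 :&: S).

(** If x and y lie on opposite sides of [S], both statements hold. Otherwise a point across the cut
    is neither x nor y, so it belongs to the union only as a lamp on which A and B differ, and the
    lamps across are exactly those kept. *)
Lemma lamp_cut_neq S p q :
  (lamp_cut S p != lamp_cut S q) = splits S (p.2 |: (q.2 |: symdiff p.1 q.1)).
Proof.
case: p q => [A x] [B y]; rewrite /lamp_cut /=.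
have xY : x \in x |: (y |: symdiff A B) by rewrite !inE eqxx.
have yY : y \in x |: (y |: symdiff A B) by rewrite !inE eqxx orbT.
have sY c : (c \in A) != (c \in B) -> c \in x |: (y |: symdiff A B).
  by move=> cAB; rewrite !inE; move: cAB; case: (c \in A) (c \in B) => [] [];
    rewrite ?orbT.
have sN c : c \in x |: (y |: symdiff A B) -> c != x -> c != y ->
    (c \in A) != (c \in B).
  by move=> + /negbTE cx /negbTE cy; rewrite !inE cx cy/=;
    case: (c \in A) (c \in B) => [] [].
case xS : (x \in S); case yS : (y \in S).
- apply/idP/idP => [/eqP ne|/andP[_ /exists_inP[b bY bS]]].
    have [c cS cAB] : exists2 c, c \notin S & (c \in A) != (c \in B).
      apply: contrapT => no; apply: ne; congr (_, _); apply/setP => c.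
      rewrite !inE; case cS : (c \in S) => //=.
      by apply/eqP/negPn/negP => cAB; apply: no; exists c; rewrite ?cS.
    exact: (splitsI xY (sY _ cAB)).
  have bAB : (b \in A) != (b \in B).
    by apply: (sN b bY); apply: contraNneq bS => ->; rewrite ?xS ?yS.
  apply: contra bAB => /eqP[/setP/(_ b)]; rewrite !inE bS/= => ->.
  by rewrite eqxx.
- by apply/esym; apply: (splitsI xY yY) => //; rewrite yS.
- by apply/esym; apply: (splitsI yY xY) => //; rewrite xS.
- apply/idP/idP => [/eqP ne|/andP[/exists_inP[b bY bS] _]].
    have [c cS cAB] : exists2 c, c \in S & (c \in A) != (c \in B).
      apply: contrapT => no; apply: ne; congr (_, _); apply/setP => c.
      rewrite !inE; case cS : (c \in S); rewrite ?andbF//= !andbT.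
      by apply/eqP/negPn/negP => cAB; apply: no; exists c; rewrite ?cS.
    by apply: (splitsI (sY _ cAB) xY) => //; rewrite xS.
  have bAB : (b \in A) != (b \in B).
    by apply: (sN b bY); apply: contraTneq bS => ->; rewrite ?xS ?yS.
  apply: contra bAB => /eqP[/setP/(_ b)]; rewrite !inE bS !andbT => ->.
  by rewrite eqxx.
Qed.

Definition path_sum (F : X -> X -> R) x (s : seq X) : R :=
  \sum_(d <- pairmap F x s) d.

Lemma path_sum_cons F x y s : path_sum F x (y :: s) = F x y + path_sum F y s.
Proof. by rewrite /path_sum /= big_cons. Qed.

Lemma path_sum_nil F x : path_sum F x [::] = 0.
Proof. by rewrite /path_sum big_nil. Qed.

Lemma path_sum_ge0 F x s : (forall a b, 0 <= F a b) -> 0 <= path_sum F x s.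
Proof.
move=> F0; elim: s x => [|y s IHs] x; first by rewrite path_sum_nil.
by rewrite path_sum_cons addr_ge0.
Qed.

Lemma le_path_sum F (b : R) x s : (forall u v, F u v <= b * mdist u v) ->
  path_sum F x s <= b * walk_length x s.
Proof.
move=> Fb; elim: s x => [|y s IHs] x.
  by rewrite path_sum_nil walk_length_nil mulr0.
by rewrite path_sum_cons walk_length_cons mulrDr lerD.
Qed.

Lemma path_sum_linear (I : finType) (w : I -> R) (F : I -> X -> X -> R) x s :
  \sum_i w i * path_sum (F i) x s =
  path_sum (fun a b => \sum_i w i * F i a b) x s.
Proof.
elim: s x => [|y s IHs] x.
  by rewrite path_sum_nil big1// => i _; rewrite path_sum_nil mulr0.
rewrite path_sum_cons -IHs -big_split; apply: eq_bigr => i _ /=.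
by rewrite path_sum_cons mulrDr.
Qed.

Definition crossing S x y : R := ((x \in S) != (y \in S))%:R.

Lemma crossing_ge1 S x s z : z \in x :: s -> (z \in S) != (x \in S) ->
  1 <= path_sum (crossing S) x s.
Proof.
have cr0 a b : 0 <= crossing S a b by rewrite ler0n.
elim: s x => [|y s IHs] x; first by rewrite inE => /eqP->; rewrite eqxx.
rewrite inE => /predU1P[->|zs]; first by rewrite eqxx.
rewrite path_sum_cons => zx.
have [zy|zy] := eqVneq (z \in S) (y \in S).
  by rewrite /crossing -zy eq_sym zx lerDl path_sum_ge0.
by rewrite (le_trans (IHs y zs zy))// lerDr.
Qed.

Lemma splits_le_crossings S Y x s : {subset Y <= x :: s} ->
  (splits S Y)%:R <= path_sum (crossing S) x s.
Proof.
move=> sY; case: (boolP (splits S Y)) => [|_]; last first.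
  by rewrite path_sum_ge0// => a b; rewrite ler0n.
move=> /andP[/exists_inP[a /sY a_s aS] /exists_inP[b /sY bs /negbTE bS]].
(* Whichever of [a], [b] lies opposite to the start [x] forces a crossing. *)
case xS : (x \in S); [apply: crossing_ge1 bs _|apply: crossing_ge1 a_s _].
  by rewrite bS xS.
by rewrite aS xS.
Qed.

(** The cuts account for the tsp term, and one extra coordinate per lamp for the term |C|;
    [1 <= alpha] and [1 <= beta] keep the latter within both bounds. *)
Lemma La_embeds_of_cuts (I : finType) (w : I -> R) (S : I -> {set X})
    (alpha beta : R) :
  (0 < #|X|)%N -> 1 <= alpha -> 1 <= beta -> (forall i, 0 <= w i) ->
  (forall x y, \sum_i w i * crossing (S i) x y <= beta * mdist x y) ->
  (forall x C y, tsp x C y <=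
     alpha * \sum_i w i * (splits (S i) (x |: (y |: C)))%:R) ->
  L1_embeds (La X) (alpha * beta).
Proof.
move=> X0 alpha1 beta1 w0 crossP splitP.
have alpha0 : 0 < alpha by rewrite (lt_le_trans ltr01).
(* [inr a] reads lamp [a]; the empty set only pads it to the common value type. *)
pose g (p : La X) (j : I + X) := match j with
  | inl i => lamp_cut (S i) p
  | inr a => (a \in p.1, finset.set0) end.
apply: (@L1_embeds_of_weighted_discrete _ _ (I + X)%type (bool * {set X})%type
  (fun j => if j is inl i then w i else 1) g alpha^-1).
- by rewrite invr_gt0.
- by rewrite card_sum addn_gt0 X0 orbT.
- by apply/card_gt0P; exists (true, finset.set0).
- by case.
move=> p q; rewrite big_sumType/=.
under eq_bigr do rewrite lamp_cut_neq.
set C := symdiff p.1 q.1.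
rewrite [X in _ + X](_ : _ = #|C|%:R); last first.
  rewrite -sum1_card natr_sum [RHS]big_mkcond/=; apply: eq_bigr => a _.
  rewrite mul1r xpair_eqE eqxx andbT /C /symdiff !inE.
  by case: (a \in p.1) (a \in q.1) => [] [].
have -> : mdist p q = tsp p.2 C q.2 + #|C|%:R by [].
have -> : alpha * beta / alpha = beta by rewrite mulrAC mulfV ?gt_eqF// mul1r.
rewrite ler_pdivrMl// !mulrDr; apply/andP; split.
  by rewrite lerD ?splitP// ler_peMl.
rewrite lerD ?ler_peMl//.
have [s [sy Cs] ->] := tsp_attained p.2 C q.2.
apply: le_trans (le_path_sum p.2 s crossP); rewrite -path_sum_linear.
apply: ler_sum => i _; rewrite ler_wpM2l// splits_le_crossings// => z.
by case/setU1P => [->|/setU1P[->|/Cs//]];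
  [exact: mem_head|rewrite -sy mem_last].
Qed.

End Cuts.

(** * Tours and random partitions *)

Section Tours.
Variables (R : realType) (X : finMetricType R).
Implicit Types (Y : {set X}) (x : X).

Lemma tour_le_clusters (c : nat -> X -> X) (h : R) (M : nat) Y x :
  0 <= h ->
  (forall k u v, c k u = c k v -> mdist u v <= 2 * (k%:R * h)) ->
  (forall u v : X, mdist u v <= 2 * (M%:R * h)) ->
  x \in Y ->
  exists2 s, tsp_walk x Y x s &
    walk_length x s <= 4 * \sum_(k < M) h * (#|c k @: Y|%:R - 1).
Proof.
move=> h0 cP diamM; have [n] := ubnP #|Y|; elim: n Y => // n IHn Y leYn xY.
have [Y0|[a]] := set_0Vmem (Y :\ x).
  exists [::].
    split=> // z zY; rewrite inE; apply/negPn/negP => zx.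
    by have := finset.in_set0 z; rewrite -Y0 !inE zx zY.
  rewrite walk_length_nil mulr_ge0// sumr_ge0// => k _; rewrite mulr_ge0//.
  rewrite subr_ge0 ler1n; apply/card_gt0P; exists (c k x).
  exact: imset_f.
rewrite !inE => /andP[ax aY]; pose Y' := Y :\ a.
have xY' : x \in Y' by rewrite !inE eq_sym ax.
have cardY : #|Y| = #|Y'|.+1 by rewrite (cardsD1 a) aY.
have [|s [sx Y's] sle] := IHn Y' _ xY'; first by rewrite -ltnS -cardY.
case: (@arg_minP _ _ _ x (fun b => b \in Y') (mdist a) xY') => b bY' bmin.
have bs := Y's b bY'; move: bs sx Y's sle.
case/splitPl => p1 p2 lastp1 sx Y's sle.
(* The detour from [b], a point of [Y'] nearest to [a], to [a] and back costs 2 d(a, b), that is, 4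
   times d(a, b) / 2. *)
exists (p1 ++ [:: a, b & p2]).
  split; first by move: sx; rewrite !last_cat/= lastp1.
  move=> z zY; have [->|za] := eqVneq z a.
    by rewrite inE mem_cat !inE eqxx !orbT.
  have := Y's z; rewrite !inE za zY => /(_ isT); rewrite !mem_cat !inE.
  by case/or3P => ->; rewrite ?orbT.
apply: (@le_trans _ _ (walk_length x (p1 ++ p2) + 4 * (mdist a b / 2))).
  rewrite !walk_length_cat lastp1 !walk_length_cons (metric_sym b a); lra.
apply: le_trans (lerD sle (lexx _)) _; rewrite -mulrDr ler_pM2l//.
(* The grid reaches d(a, b) / 2, so its radii below that value pay for the detour. *)
have dM : mdist a b / 2 <= M%:R * h by have := diamM a b; lra.
apply: le_trans (lerD (lexx _) (sum_grid_below_ge h0 dM)) _.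
rewrite -big_split/=; apply: ler_sum => k _; rewrite -mulrDr ler_wpM2l//.
(* As long as 2 k h < d(a, Y'), the cluster of a misses Y'. *)
rewrite addrAC lerD2r -natrD ler_nat -(finset.setD1K aY) imsetU1 cardsU1 addnC.
rewrite leq_add2r; case: ltP => // kh.
suff -> : c k a \notin [set c k x | x in Y :\ a] by [].
apply/negP => /imsetP[d dY' /cP ad].
by have := bmin d dY'; lra.
Qed.

(** Follow a closed tour from x, then step to y. As the tour visits y, the last step is no longer
    than the tour, so the constant 4 doubles. *)
Lemma tsp_le_clusters (c : nat -> X -> X) (h : R) (M : nat) x C y :
  0 <= h ->
  (forall k u v, c k u = c k v -> mdist u v <= 2 * (k%:R * h)) ->
  (forall u v : X, mdist u v <= 2 * (M%:R * h)) ->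
  tsp x C y <= 8 * \sum_(k < M) h * (#|c k @: (x |: (y |: C))|%:R - 1).
Proof.
move=> h0 cP diamM; set Y := x |: _.
have xY : x \in Y by rewrite !inE eqxx.
have yY : y \in Y by rewrite !inE eqxx orbT.
have [s [sx Ys] sle] := tour_le_clusters h0 cP diamM xY.
have xy : mdist x y <= walk_length x s.
  case/splitPl: (Ys y yY) => p1 p2 <-.
  rewrite walk_length_cat (le_trans (mdist_le_walk_length _ _))//.
  by rewrite lerDl walk_length_ge0.
apply: (@le_trans _ _ (walk_length x (rcons s y))).
  apply: tsp_le; split; first by rewrite last_rcons.
  move=> z zC; have := Ys z; rewrite !inE zC !orbT => /(_ isT).
  by rewrite mem_rcons inE => /orP[->|->]; rewrite ?orbT.
rewrite -cats1 walk_length_cat walk_length_cons walk_length_nil sx addr0.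
move: sle xy; set S := \sum_(_ < _) _; lra.
Qed.

End Tours.

(** * Separation probabilities of random partitions *)

Section RandomPartitions.
Variables (R : realType) (X : finMetricType R).
Implicit Types (pi : {perm X}) (r : R) (u v w : X).

Definition rank_in pi w : nat := enum_rank (pi w).

Lemma rank_in_inj pi : injective (rank_in pi).
Proof. by move=> u v /val_inj/enum_rank_inj/perm_inj. Qed.

Definition first_in (W : {set X}) w pi : bool :=
  [forall v in W, (rank_in pi w <= rank_in pi v)%N].

(** The default [u] is admissible as soon as 0 <= r. *)
Definition first_center pi r u : X :=
  arg_min u (fun w => mdist u w <= r) (rank_in pi).

Lemma first_centerP pi r u : 0 <= r -> mdist u (first_center pi r u) <= r /\
  forall w, mdist u w <= r ->
    (rank_in pi (first_center pi r u) <= rank_in pi w)%N.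
Proof.
move=> r0; rewrite /first_center.
by case: arg_minnP; [rewrite mdistxx|split].
Qed.

Lemma first_center_eq_mdist pi r u v :
  0 <= r -> first_center pi r u = first_center pi r v ->
  mdist u v <= 2 * r.
Proof.
move=> r0 uv; have [ucu _] := first_centerP pi u r0;
  have [vcv _] := first_centerP pi v r0.
apply: le_trans (metric_triangle _ (first_center pi r u) _) _.
by rewrite mulr_natl mulr2n lerD// uv metric_sym.
Qed.

(** [w] is within r of exactly one of [u], [v] when r lies in [near_dist, far_dist[. *)
Definition near_dist u v w := Num.min (mdist u w) (mdist v w).
Definition far_dist u v w := Num.max (mdist u w) (mdist v w).

Lemma far_dist_sub u v w : far_dist u v w - near_dist u v w <= mdist u v.
Proof.
have := metric_triangle u v w; have := metric_triangle v u w.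
rewrite (metric_sym v u) /far_dist /near_dist.
by case: (ltP (mdist u w) (mdist v w)) => *; lra.
Qed.

(** Take for w the [pi]-first point within r of u or v. Were it within r of both, it would be the
    center of both. *)
Lemma first_center_neq_witness pi r u v :
  0 <= r -> first_center pi r u != first_center pi r v ->
  exists w, (near_dist u v w <= r < far_dist u v w) &&
    first_in [set w' | near_dist u v w' <= near_dist u v w] w pi.
Proof.
move=> r0 uv.
have [ucu umin] := first_centerP pi u r0.
have [vcv vmin] := first_centerP pi v r0.
have Pu : near_dist u v u <= r by rewrite /near_dist mdistxx ge_min r0.
case: (@arg_minnP _ u (fun w => near_dist u v w <= r) (rank_in pi) Pu)
  => w wr wmin.
exists w; rewrite wr/=; apply/andP; split; last first.
  apply/forall_inP => w'; rewrite inE => w'w.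
  apply: wmin; exact: le_trans wr.
rewrite ltNge ge_max; apply: contra uv => /andP[uw vw].
suff [-> ->] : first_center pi r u = w /\ first_center pi r v = w by [].
split; apply: (@rank_in_inj pi); apply/eqP; rewrite eqn_leq ?umin ?vmin//=;
  by rewrite wmin// /near_dist ge_min ?ucu ?vcv ?orbT.
Qed.

(* The transposition of v and w exchanges the two events. *)
Lemma card_first_in_perm (W : {set X}) v w : v \in W -> w \in W ->
  #|[set pi | first_in W v pi]| = #|[set pi | first_in W w pi]|.
Proof.
move=> vW wW; pose t : {perm X} := tperm v w.
rewrite -(card_imset _ (@mulgI _ t)); apply: eq_card => pi; rewrite inE.
have tW z : (t z \in W) = (z \in W).
  by rewrite /t; case: tpermP => [->|->|]; rewrite ?vW ?wW.
apply/imsetP/forall_inP => [[rho]|piP].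
  rewrite inE => /forall_inP rhoP -> z zW.
  by rewrite /rank_in !permM tpermR; apply: (rhoP (t z)); rewrite tW.
exists (t * pi)%g; last by rewrite mulgA tperm2 mul1g.
rewrite inE; apply/forall_inP => z zW; rewrite /rank_in !permM tpermL.
by apply: (piP (t z)); rewrite tW.
Qed.

Lemma card_first_in (W : {set X}) w : w \in W ->
  (#|[set pi | first_in W w pi]| * #|W| <= #|{perm X}|)%N.
Proof.
move=> wW.
(* The events for distinct w are disjoint and equiprobable. *)
rewrite mulnC -sum_nat_const.
rewrite (eq_bigr (fun v => \sum_(pi : {perm X}) (first_in W v pi : nat)))
  => [|v vW].
  rewrite exchange_big/= -sum1_card; apply: leq_sum => pi _.
  rewrite -big_mkcondr/= sum1_card.
  apply/card_le1_eqP => a b /andP[aW /forall_inP aP] /andP[bW /forall_inP bP].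
  by apply: (@rank_in_inj pi); apply/eqP; rewrite eqn_leq aP// bP.
rewrite (card_first_in_perm wW vW) -sum1_card big_mkcond/=.
by apply: eq_bigr => pi _; rewrite inE.
Qed.

(** Union bound over the witness w: its radii contribute at most 2 d(u, v), its permutations a
    proportion at most 1/|W w|, and these proportions add up to at most a harmonic sum. *)
Lemma sum_first_center_neq_le u v (h : R) (M : nat) :
  0 <= h -> h <= mdist u v ->
  \sum_(pi : {perm X}) \sum_(k < M)
     h * (first_center pi (k%:R * h) u != first_center pi (k%:R * h) v)%:R <=
  #|{perm X}|%:R * (2 * mdist u v * \sum_(i < #|X|) (i.+1%:R)^-1).
Proof.
move=> h0 huv.
pose W w := [set w' | near_dist u v w' <= near_dist u v w].
pose cut k w : bool :=
  (near_dist u v w <= k%:R * h) && (k%:R * h < far_dist u v w).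
have sep pi (k : nat) :
    (first_center pi (k%:R * h) u != first_center pi (k%:R * h) v)%:R <=
    \sum_w (cut k w)%:R * (first_in (W w) w pi)%:R :> R.
  have terms0 w : 0 <= (cut k w)%:R * (first_in (W w) w pi)%:R :> R.
    by rewrite mulr_ge0.
  case: (boolP (_ != _)) => [/first_center_neq_witness[|w /andP[w1 w2]]|_].
  - by rewrite mulr_ge0.
  - rewrite (bigD1 w)//= /cut w1 /W w2 mulr1 lerDl sumr_ge0//.
  - exact: sumr_ge0.
(* [cut] depends only on the radius and [first_in] only on [pi], so the double sum factorises for
   each w. *)
apply: (@le_trans _ _ (\sum_w (\sum_(k < M) h * (cut k w)%:R) *
    (\sum_(pi : {perm X}) (first_in (W w) w pi)%:R))).
  under [leRHS]eq_bigr do rewrite mulr_sumr.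
  rewrite [leRHS]exchange_big/=; apply: ler_sum => pi _.
  under [leRHS]eq_bigr do rewrite mulr_suml.
  rewrite [leRHS]exchange_big/=; apply: ler_sum => k _.
  under [leRHS]eq_bigr do rewrite -mulrA.
  by rewrite -mulr_sumr ler_wpM2l.
have := sum_inv_card_le_harmonic (near_dist u v) [set: X].
rewrite cardsT => harm.
rewrite mulrA; apply: le_trans (ler_wpM2l _ harm); last first.
  by rewrite !mulr_ge0 ?mdist_ge0.
rewrite mulr_sumr [leRHS]big_mkcond/=; apply: ler_sum => w _; rewrite inE.
rewrite [#|{perm X}|%:R * _]mulrC -mulrA ler_pM ?sumr_ge0//.
- by move=> k _; rewrite mulr_ge0.
- apply: (le_trans (sum_grid_interval_le _ h0 _)).
    by rewrite /near_dist /far_dist ge_min le_max !lexx.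
  (* The grid error h is absorbed by [h <= mdist u v], whence the factor 2. *)
  by rewrite mulr_natl mulr2n lerD// far_dist_sub.
have wW : w \in W w by rewrite inE.
have Wpos : 0 < #|W w|%:R :> R by rewrite ltr0n; apply/card_gt0P; exists w.
rewrite (_ : [set v0 in _ | _] = W w); last by apply/setP => z; rewrite !inE.
rewrite ler_pdivlMr//.
have -> : \sum_(pi : {perm X}) (first_in (W w) w pi)%:R =
    #|[set pi | first_in (W w) w pi]|%:R :> R.
  rewrite -sum1_card natr_sum [RHS]big_mkcond/=; apply: eq_bigr => pi _.
  by rewrite inE; case: first_in.
by rewrite -natrM ler_nat card_first_in.
Qed.

End RandomPartitions.

(** * The embedding *)

Section LamplighterL1.
Variables (R : realType) (X : finMetricType R).

Lemma mdist_gt0 (x y : X) : (0 < mdist x y) = (x != y).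
Proof.
rewrite lt0r mdist_ge0 andbT; congr negb; apply/eqP/eqP => [|->].
  exact: mdist_positivity.
exact: mdistxx.
Qed.

Lemma mdist_lower_bound :
  exists2 h : R, 0 < h & forall x y : X, x != y -> h <= mdist x y.
Proof.
(* The default 1 keeps the minimum positive when no two points are distinct. *)
exists (\big[Num.min/1]_(p : X * X | p.1 != p.2) mdist p.1 p.2).
  by apply: lt_bigmin => // p; rewrite mdist_gt0.
by move=> x y xy; rewrite (bigmin_le_cond _ (j := (x, y))).
Qed.

Lemma mdist_upper_bound (h : R) : 0 < h ->
  exists M : nat, forall x y : X, mdist x y <= M%:R * h.
Proof.
move=> h0; exists (Num.bound (\sum_(p : X * X) mdist p.1 p.2 / h)) => x y.
have dh0 (p : X * X) : 0 <= mdist p.1 p.2 / h.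
  by rewrite divr_ge0 ?mdist_ge0// ltW.
rewrite -ler_pdivrMr//; apply/ltW/(le_lt_trans _ (archi_boundP _)).
  by rewrite (bigD1 (x, y))//= lerDl sumr_ge0.
exact: sumr_ge0.
Qed.

(** If at least two clusters meet [Y], each of these splits [Y]; otherwise the left side is at most
    0. *)
Lemma card_clusters_le_splits (c : X -> X) (Y : {set X}) :
  #|c @: Y|%:R - 1 <= \sum_w (splits [set u | c u == w] Y)%:R :> R.
Proof.
have [le1|gt1] := leqP #|c @: Y| 1.
  rewrite (@le_trans _ _ 0) ?sumr_ge0//.
  by rewrite subr_le0 lern1.
apply: (@le_trans _ _ #|c @: Y|%:R); first by rewrite gerBl.
rewrite -sum1_card natr_sum big_mkcond/=; apply: ler_sum => w _.
case: ifP => // /imsetP[a aY wa].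
rewrite ler1n lt0b.
have /card_gt0P[w'] : (0 < #|(c @: Y) :\ w|)%N.
  by move: gt1; rewrite (cardsD1 w) wa imset_f.
rewrite !inE => /andP[w'w /imsetP[b bY w'b]].
by apply: (splitsI aY bY); rewrite inE; [rewrite wa | rewrite -w'b].
Qed.

Lemma La_embeds_harmonic : (0 < #|X|)%N ->
  L1_embeds (La X) (8 * (4 * \sum_(i < #|X|) (i.+1%:R)^-1)).
Proof.
move=> X0; set H := \sum_(i < _) _.
have H1 : 1 <= H.
  rewrite /H; case: #|X| X0 => // n _; rewrite big_ord_recl invr1 lerDl.
  exact: sumr_ge0.
have [h h0 hP] := mdist_lower_bound.
have [M MP] := mdist_upper_bound h0.
have r0 (k : nat) : 0 <= k%:R * h by rewrite mulr_ge0// ltW.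
pose N : R := #|{perm X}|%:R.
have N0 : 0 < N by rewrite ltr0n; apply/card_gt0P; exists 1%g.
(* One cut per permutation, grid radius and center; the weight [N^-1 * h] averages over permutations
   and integrates over radii. *)
pose S (i : {perm X} * 'I_M * X) : {set X} :=
  [set u | first_center i.1.1 (i.1.2%:R * h) u == i.2].
have sumE (F : {perm X} * 'I_M * X -> R) :
    \sum_i N^-1 * h * F i =
    N^-1 * \sum_(pi : {perm X}) \sum_(k < M) h * \sum_w F (pi, k, w).
  transitivity (\sum_pi \sum_k \sum_w N^-1 * h * F (pi, k, w)).
    by rewrite !pair_bigA; apply: eq_bigr => -[[]].
  rewrite mulr_sumr; apply: eq_bigr => pi _.
  rewrite mulr_sumr; apply: eq_bigr => k _.
  by rewrite mulrA mulr_sumr.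
apply: (@La_embeds_of_cuts _ _ _ (fun=> N^-1 * h) S) => //.
- by rewrite ler1n.
- by rewrite (le_trans H1)// ler_peMl ?ler1n// (le_trans ler01).
- by move=> _; rewrite mulr_ge0 ?invr_ge0// ltW.
- move=> x y; have [->|xy] := eqVneq x y.
    rewrite big1 => [|i _]; first by rewrite mdistxx mulr0.
    by rewrite /crossing eqxx mulr0.
  rewrite sumE ler_pdivrMl//.
  have := sum_first_center_neq_le M (ltW h0) (hP _ _ xy); rewrite -/H -/N => le.
  (* The outer 2 arises because separated points cross both of their clusters; the inner one is the
     grid loss. *)
  apply: (@le_trans _ _ (2 * (N * (2 * mdist x y * H)))); last by lra.
  apply: le_trans (ler_wpM2l _ le); last by [].
  rewrite mulr_sumr; apply: ler_sum => pi _.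
  rewrite mulr_sumr; apply: ler_sum => k _.
  rewrite mulrCA ler_pM2l// -sum_norm_diff_pred1; apply: ler_sum => w _.
  rewrite /crossing !inE/=.
  by do 2!case: (_ == w);
    rewrite /= ?subrr ?subr0 ?sub0r ?normrN ?normr0 ?normr1.
move=> x C y; rewrite sumE mulrCA ler_pdivlMl//.
(* The tsp bound holds for every permutation separately, hence on average. *)
rewrite [N * _]mulr_natl -sumr_const mulr_sumr.
apply: ler_sum => pi _.
have cP k u v : first_center pi (k%:R * h) u = first_center pi (k%:R * h) v ->
    mdist u v <= 2 * (k%:R * h) by exact: first_center_eq_mdist.
have diamM (u v : X) : mdist u v <= 2 * (M%:R * h).
  by have := MP u v; have := r0 M; lra.
apply: le_trans (tsp_le_clusters x C y (ltW h0) cP diamM) _.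
rewrite ler_pM2l//; apply: ler_sum => k _; rewrite ler_pM2l//.
exact: card_clusters_le_splits.
Qed.

End LamplighterL1.

Lemma L1_embeds_le (R : realType) (M : metricType R) (D D' : R) :
  D <= D' -> L1_embeds M D -> L1_embeds M D'.
Proof.
move=> DD' [s [s0 [f [fi fP]]]]; exists s; split=> //; exists f; split=> // x y.
have /andP[-> le] := fP x y; rewrite (le_trans le)//.
by rewrite ler_wpM2r ?mdist_ge0// ler_wpM2r// ltW.
Qed.

(** * From harmonic sums to logarithms *)

Section Log2.
Variable R : realType.

Lemma ln2_gt0 : 0 < ln 2 :> R.
Proof. by rewrite ln_gt0// ltr1n. Qed.

Lemma ler_log2 (x y : R) : 0 < x -> x <= y -> log2 x <= log2 y.
Proof.
move=> x0 xy; rewrite ler_pM2r ?invr_gt0 ?ln2_gt0// ler_ln ?posrE//.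
exact: lt_le_trans xy.
Qed.

Lemma log2_two : log2 2 = 1 :> R.
Proof. by rewrite /log2 divff// gt_eqF ?ln2_gt0. Qed.

Lemma log2_expr2 (n : nat) : log2 (2 ^+ n) = n%:R :> R.
Proof. by rewrite /log2 lnXn// mulrnAl divff// gt_eqF ?ln2_gt0. Qed.

(** Both 1 and ln n are at most log2 n: the former as n >= 2, the latter as ln 2 <= 1. *)
Lemma harmonic_le_log2 (n : nat) : (2 <= n)%N ->
  \sum_(i < n) (i.+1%:R : R)^-1 <= 2 * log2 n%:R.
Proof.
case: n => [//|n] n2; apply: (le_trans (harmonic_le_ln _ _)).
have l1 : 1 <= log2 n.+1%:R :> R by rewrite -[leLHS]log2_two ler_log2// ler_nat.
suff : ln n.+1%:R <= log2 n.+1%:R :> R by lra.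
rewrite ler_pdivlMr ?ln2_gt0// ler_piMr ?ln_ge0 ?ler1n//.
by apply: le_trans (le_ln1Dx (_ : -1 < 1)) _; rewrite ?ltrN10.
Qed.

(** |La X| = 2^n n >= 2^n with n = |X|; take logarithms twice. *)
Lemma log2_card_le (X : finMetricType R) : (2 <= #|X|)%N ->
  log2 #|X|%:R <= log2 (log2 #|{: La X}|%:R) :> R.
Proof.
move=> X2; have X0 : (0 < #|X|)%N by exact: leq_trans X2.
apply: ler_log2; first by rewrite ltr0n.
rewrite -log2_expr2; apply: ler_log2; first by rewrite exprn_gt0.
rewrite -natrX ler_nat card_prod -cardsT -powersetT card_powerset cardsT.
exact: leq_pmulr.
Qed.

End Log2.

Theorem corollary8 (R : realType) :
  (exists K : R, 0 < K /\
     forall X : finMetricType R, (2 <= #|X|)%N ->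
       L1_embeds (La X) (K * log2 #|X|%:R)) /\
  (exists C : R, 0 < C /\
     forall X : finMetricType R, (2 <= #|X|)%N ->
       log2 #|X|%:R <= C * log2 (log2 #|{: La X}|%:R)) /\
  (exists K' : R, 0 < K' /\
     forall X : finMetricType R, (2 <= #|X|)%N ->
       L1_embeds (La X) (K' * log2 (log2 #|{: La X}|%:R))).
Proof.
have embeds (X : finMetricType R) : (2 <= #|X|)%N ->
    L1_embeds (La X) (64 * log2 #|X|%:R).
  (* 64 = 8 * 4 * 2, the last factor from bounding the harmonic sum by 2 log2 n. *)
  move=> X2; apply: L1_embeds_le (La_embeds_harmonic _);
    last exact: leq_trans X2.
  by have := harmonic_le_log2 R X2; lra.
split; first by exists 64; split; rewrite ?ltr0n.
split; [exists 1|exists 64]; split; rewrite ?ltr0n// => X X2.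
  by rewrite mul1r log2_card_le.
by apply: L1_embeds_le (embeds X X2); rewrite ler_pM2l ?ltr0n// log2_card_le.
Qed.
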